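(* Let $S$ be a local energy with range $r$ and constants $K,\lambda>0$, and set $c:=\frac{2K^2(2r+1)}{\lambda}$. Let $x,y\in\mathcal{M}$ be global minimizers whose domain of crossing $D=[j_0,j_1]$ is non-empty and bounded. Then the size of $D$ is uniformly bounded by $$|D|=j_1-j_0\le \tilde K:=\left\lceil 12\,r\,\lambda^{-2}c^2+3r\right\rceil .$$ In particular the bound depends only on $r$, $\lambda$ and $K$, and not on $x$ and $y$.
   Context: Let $r\ge 1$ be an integer. A local energy with range $r$ and constants $K,\lambda>0$ is a function $S\in C^2(\mathbb{R}^{r+1})$ for which there are $f_1,\dots,f_r\in C^2(\mathbb{R}^2)$ with $S(\xi_1,\dots,\xi_{r+1})=\sum_{j=1}^r f_j(\xi_1,\xi_{j+1})$ such that for every $1\le j\le r$: (1) $f_j(\nu+1,\mu+1)=f_j(\nu,\mu)$; (2) $\|\partial_{i,k}f_j\|_{\sup}\le K/r$ for all $i,k\in\{1,2\}$; (3) $f_j(\nu,\mu)\to\infty$ as $|\nu-\mu|\to\infty$; (4) $\partial_1\partial_2 f_j(\nu,\mu)\le-\lambda<0$ for all $\nu,\mu\in\mathbb{R}$. For $x\in\mathbb{R}^{\mathbb{Z}}$ put $S_j(x):=S(x_j,\dots,x_{j+r})$. For integers $i_0\le i_1$ let $B=[i_0-r,i_1]\subset\mathbb{Z}$, with interior $\mathring{B}=[i_0,i_1]$, and $W_B(x):=\sum_{i\in B}S_i(x)$. A sequence $x\in\mathbb{R}^{\mathbb{Z}}$ is a global minimizer if $W_B(x)\le W_B(x+v)$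 for every such $B$ and every $v\in\mathbb{R}^{\mathbb{Z}}$ supported in $\mathring{B}$; $\mathcal{M}$ is the set of global minimizers. Domain of crossing: for $x,y\in\mathbb{R}^{\mathbb{Z}}$ it is the interval $D\subset\mathbb{Z}$ (of the form $\varnothing$, $[j_0,j_1]$, $[j_0,\infty)$, $(-\infty,j_1]$ or $\mathbb{Z}$), minimal with respect to inclusion, such that on each connected component of $\mathbb{Z}\setminus D$ the sequences $x,y$ are weakly ordered (either $x_i\le y_i$ for all $i$ in the component or $x_i\ge y_i$ for all $i$ in the component); the ordering may differ on the two components. If the minimal interval is not unique (it is then a single point), any such choice is allowed. For $D=[j_0,j_1]$, $|D|=j_1-j_0$. *)

(* Defs.v *)
From HB Require Import structures.
From mathcomp Require Import all_boot all_order all_algebra.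
From mathcomp Require Import all_classical all_reals all_analysis.
Set Implicit Arguments.
Unset Strict Implicit.
Unset Printing Implicit Defensive.
Import Order.TTheory GRing.Theory Num.Theory.
Import numFieldNormedType.Exports.

Local Open Scope classical_set_scope.
Local Open Scope ring_scope.

Section Smoothness.
Context {R : realType} {n : nat}.
Implicit Types f : 'rV[R]_n.+1 -> R.

Definition partial (i : 'I_n.+1) f : 'rV[R]_n.+1 -> R :=
  fun p => 'D_(delta_mx 0 i) f p.

Definition is_C1 f : Prop :=
  [/\ continuous f,
      forall i p, derivable f p (delta_mx 0 i)
    & forall i, continuous (partial i f)].

Definition is_C2 f : Prop := is_C1 f /\ forall i, is_C1 (partial i f).

Definition sup_norm f : \bar R := ereal_sup (range (fun p => `|f p|%:E)).

End Smoothness.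

Definition pt2 {R : realType} (nu mu : R) : 'rV[R]_2 :=
  \row_(i < 2) (if i == 0 then nu else mu).

(* The 'j : 'I_r' below is the 1-based index minus one; accordingly the
   coordinates xi_1 and xi_(j+1) are 'xi 0 ord0' and 'xi 0 (lift ord0 j)', and
   the partial derivatives d_1, d_2 on the plane have indices 0, 1 : 'I_2. *)
Definition is_local_energy {R : realType} (r : nat) (K lam : R)
    (S : 'rV[R]_r.+1 -> R) : Prop :=
  is_C2 S /\
  exists f : 'I_r -> 'rV[R]_2 -> R,
    [/\ forall j, is_C2 (f j),
        forall xi, S xi = \sum_(j < r) f j (pt2 (xi 0 ord0) (xi 0 (lift ord0 j)))
      & forall j,
        [/\ forall nu mu, f j (pt2 (nu + 1) (mu + 1)) = f j (pt2 nu mu),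
            forall i k : 'I_2,
              (sup_norm (partial i (partial k (f j))) <= (K / r%:R)%:E)%E,
            forall M : R, exists A : R, forall nu mu : R,
              A <= `|nu - mu| -> M <= f j (pt2 nu mu)
          & forall nu mu,
              partial 0 (partial 1 (f j)) (pt2 nu mu) <= - lam]].

Section Minimizers.
Context {R : realType} {r : nat}.
Variable S : 'rV[R]_r.+1 -> R.
Implicit Types x v : int -> R.

Definition site_energy (j : int) x : R :=
  S (\row_(k < r.+1) x (j + (k : nat)%:Z)).

(* W_B for B = [i0 - r, i1], given through the end points of its interior. *)
Definition block_energy (i0 i1 : int) x : R :=
  \sum_(i \in [set i : int | i0 - r%:Z <= i <= i1]) site_energy i x.

Definition global_minimizer x : Prop :=
  forall (i0 i1 : int) v, i0 <= i1 ->
    (forall i : int, ~~ (i0 <= i <= i1) -> v i = 0) ->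
    block_energy i0 i1 x <= block_energy i0 i1 (fun i => x i + v i).

End Minimizers.

Section Crossing.
Context {R : realType}.
Implicit Types (x y : int -> R) (A C D : set int).

(* C is a maximal nonempty integer interval contained in A. *)
Definition zcomponent A C : Prop :=
  [/\ C !=set0, is_interval C, C `<=` A
    & forall C', is_interval C' -> C' `<=` A -> C `<=` C' -> C' = C].

Definition weakly_ordered_on C x y : Prop :=
  (forall i, C i -> x i <= y i) \/ (forall i, C i -> y i <= x i).

Definition ordered_off D x y : Prop :=
  forall C, zcomponent (~` D) C -> weakly_ordered_on C x y.

Definition domain_of_crossing x y D : Prop :=
  [/\ is_interval D, ordered_off D x y
    & forall D', is_interval D' -> ordered_off D' x y -> D' `<=` D -> D' = D].

End Crossing.

(* Main.v *)
Require Import Defs.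
From mathcomp Require Import all_boot all_order all_algebra.
From mathcomp Require Import all_classical all_reals all_analysis.
From mathcomp Require Import zify ring lra.
Import Order.TTheory GRing.Theory Num.Theory.
Import numFieldNormedType.Exports.
Local Open Scope classical_set_scope.
Local Open Scope ring_scope.

(** Put z = x - y.  Exchanging the values of x and y on a finite set A of sites
turns the two minimizers into two competitors.  Bonds inside A and bonds outside
A keep their total energy.  By the twist condition, a bond between i in A and l
outside A saves at least lam |z_i z_l| when z_i and z_l have opposite signs (a
crossing of x and y), and costs at most (K/r) |z_i z_l| when they have the same
sign.  Since the competitors cannot have less energy than x and y, the same-sign
products over the boundary of A dominate the crossing products.  There is more:
at a site j outside A the competitor of x feels a force at least lam times the
mass of z on the part of A in range of j, so that moving its value at j lowers
the energy further, by a quadratic amount.  The resulting inequality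
[exchange_stable_minimizers] is all that is retained of minimality; it follows
from bounds on second differences of the f_j.

Say x <= y to the left of D, so that z is positive at the first site of D.  If
the order is the same to the right of D, then A, the set of all sites where z is
positive, has no positive site outside to pay for the exchange, which is absurd
([same_order_impossible]).

If the order is reversed, cut D at a site a and take for A the positive sites to
the left of a.  The quadratic term absorbs the mass to the left of a, and the
sum of all crossing products |z_i z_l| to the left of a is bounded by the square
of the mass of the positive part of z on the r sites that follow a
([left_crossings_le_mass]); the same argument shows that this mass never vanishes
([positive_mass_gt0]).  So, on three consecutive windows of r sites, the positive
mass is everywhere at least m, where m^2 dominates the crossings on the left.
Exchanging a single negative site of the middle window shows that the negative
mass of the three windows is at least a multiple of m.  Sites in one window are
in range of each other, so the products of positive and negative masses are
crossings: those local to the three windows dominate the crossings on their left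
([left_crossings_le_local]) and, after reflection, also those on their right.
Therefore every stretch of 4r sites of D carries a fixed fraction of the finite,
positive total of all crossings, and D contains boundedly many such stretches
([crossing_count_le]).  The constant is of order (K/lam)^4 / r^3 stretches, which
is below the stated bound because r lam <= K. *)

Set Implicit Arguments.
Unset Strict Implicit.
Unset Printing Implicit Defensive.

(** * Second differences of the pair energies *)

Lemma mean_value (R : realType) (f df : R -> R) (a s : R) :
  0 <= s -> (forall u, is_derive u (1:R) f (df u)) ->
  exists c, f (a + s) - f a = s * df c.
Proof.
move=> s0 fdf.
have cont : {within `[a, a + s], continuous f}.
  apply: derivable_within_continuous => u _.
  exact: (@ex_derive _ _ _ _ _ _ _ (fdf u)).
have le_as : a <= a + s by rewrite lerDl.
have [c _ E] := @MVT_segment R f df a (a + s) le_as (fun u _ => fdf u) cont.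
by exists c; rewrite E [a + s]addrC addrK mulrC.
Qed.

Lemma is_derive_pt2l (R : realType) (F : 'rV[R]_2 -> R) (b u : R) :
  (forall p, derivable F p (delta_mx 0 0)) ->
  is_derive u (1:R) (fun v => F (pt2 v b)) (partial 0 F (pt2 u b)).
Proof.
move=> dF.
have E : (fun h : R => h^-1 *: ((F \o shift (pt2 u b)) (h *: delta_mx 0 0) - F (pt2 u b)))
   = (fun h : R => h^-1 *: (((fun v => F (pt2 v b)) \o shift u) (h *: 1) - F (pt2 u b))).
  apply/funext => h /=; congr (_ *: (F _ - _)).
  apply/rowP => i; rewrite !mxE eqxx /=; case: (i == 0).
    by rewrite [h *: 1]mulr1 mulr1.
  by rewrite mulr0 add0r.
split; first by have := dF (pt2 u b); rewrite /derivable E.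
by rewrite /partial /derive E.
Qed.

Lemma is_derive_pt2r (R : realType) (F : 'rV[R]_2 -> R) (a u : R) :
  (forall p, derivable F p (delta_mx 0 1)) ->
  is_derive u (1:R) (fun v => F (pt2 a v)) (partial 1 F (pt2 a u)).
Proof.
move=> dF.
have E : (fun h : R => h^-1 *: ((F \o shift (pt2 a u)) (h *: delta_mx 0 1) - F (pt2 a u)))
   = (fun h : R => h^-1 *: (((fun v => F (pt2 a v)) \o shift u) (h *: 1) - F (pt2 a u))).
  apply/funext => h /=; congr (_ *: (F _ - _)).
  apply/rowP => i; rewrite !mxE eqxx /=; case: i => -[|[|//]] // i2 /=.
  by rewrite mulr0 add0r.
split; first by have := dF (pt2 a u); rewrite /derivable E.
by rewrite /partial /derive E.
Qed.

(** The bounds on the second partial derivatives of the f_j, in the integrated form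
in which they bound changes of energy. *)
Definition twist_interaction (R : realDomainType) (lam kap : R) (g : R -> R -> R) :=
  [/\ forall a b s t, 0 <= s -> 0 <= t ->
        - (kap * (s * t)) <= g (a + s) (b + t) + g a b - g (a + s) b - g a (b + t)
          <= - (lam * (s * t)),
      forall a b t, 0 <= t ->
        g (a + t) b + g (a - t) b - g a b *+ 2 <= kap * t ^+ 2
    & forall a b t, 0 <= t ->
        g a (b + t) + g a (b - t) - g a b *+ 2 <= kap * t ^+ 2].

Lemma is_derive_translate (R : realType) (h : R -> R) (t u d : R) :
  is_derive (u + t) (1:R) h d -> is_derive u (1:R) (fun v => h (v + t)) d.
Proof.
have E : (fun e : R => e^-1 *: ((h \o shift (u + t)) (e *: 1) - h (u + t)))
   = (fun e : R => e^-1 *: (((fun v => h (v + t)) \o shift u) (e *: 1) - h (u + t))).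
  by apply/funext => e /=; rewrite addrA.
case=> dh <-; split; first by rewrite /derivable -E.
by rewrite /derive -E.
Qed.

Lemma second_difference_le (R : realType) (h dh ddh : R -> R) (kap a t : R) :
  0 <= t ->
  (forall u, is_derive u (1:R) h (dh u)) -> (forall u, is_derive u (1:R) dh (ddh u)) ->
  (forall u, ddh u <= kap) ->
  h (a + t) + h (a - t) - h a *+ 2 <= kap * t ^+ 2.
Proof.
move=> t0 h1 h2 le_kap.
have hd u : is_derive u (1:R) (fun v => h (v + t) - h v) (dh (u + t) - dh u).
  by apply: is_deriveB; apply: is_derive_translate.
have [c1 E1] := mean_value (a - t) t0 hd.
have [c2 E2] := mean_value c1 t0 h2.
rewrite subrK E2 in E1.
have := ler_wpM2l (mulr_ge0 t0 t0) (le_kap c2); rewrite -expr2 => H.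
nra.
Qed.

(** The mean value theorem is applied in the second variable first and then in the
first one, which produces the derivative partial 0 (partial 1 F) named in the
twist condition. *)
Lemma twist_of_partials (R : realType) (F : 'rV[R]_2 -> R) (lam kap : R) :
  is_C2 F ->
  (forall i k p, `|partial i (partial k F) p| <= kap) ->
  (forall nu mu, partial 0 (partial 1 F) (pt2 nu mu) <= - lam) ->
  twist_interaction lam kap (fun nu mu => F (pt2 nu mu)).
Proof.
move=> [[_ dF _] dF2] bnd tw.
have dF2d k i p : derivable (partial k F) p (delta_mx 0 i) by have [_ + _] := dF2 k; exact.
split.
- move=> a b s t s0 t0.
  have hd u : is_derive u (1:R) (fun v => F (pt2 (a + s) v) - F (pt2 a v))
     (partial 1 F (pt2 (a + s) u) - partial 1 F (pt2 a u)).
    by apply: is_deriveB; apply: is_derive_pt2r.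
  have [c1 E1] := mean_value b t0 hd.
  have [c2 E2] := mean_value a s0
      (fun u => is_derive_pt2l c1 u (dF2d 1 0)).
  have := tw c2 c1; have := bnd 0 1 (pt2 c2 c1); rewrite ler_norml => /andP[lo _] hi.
  rewrite E2 in E1.
  have st0 := mulr_ge0 s0 t0.
  have -> : forall x1 x2 x3 x4 : R, x1 + x2 - x3 - x4 = (x1 - x4) - (x3 - x2).
    by move=> *; ring.
  rewrite E1.
  have := ler_wpM2l st0 lo; have := ler_wpM2l st0 hi.
  by move=> H1 H2; apply/andP; split; lra.
- move=> a b t t0.
  exact: (@second_difference_le R (fun v => F (pt2 v b)) (fun v => partial 0 F (pt2 v b))
    (fun v => partial 0 (partial 0 F) (pt2 v b)) kap a t t0
    (fun u => is_derive_pt2l b u (dF 0)) (fun u => is_derive_pt2l b u (dF2d 0 0))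
    (fun u => le_trans (ler_norm _) (bnd 0 0 _))).
- move=> a b t t0.
  exact: (@second_difference_le R (fun v => F (pt2 a v)) (fun v => partial 1 F (pt2 a v))
    (fun v => partial 1 (partial 1 F) (pt2 a v)) kap b t t0
    (fun u => is_derive_pt2r a u (dF 1)) (fun u => is_derive_pt2r a u (dF2d 1 1))
    (fun u => le_trans (ler_norm _) (bnd 1 1 _))).
Qed.

(** * The exchange inequality *)

Definition posp {R : realDomainType} (t : R) : R := Num.max t 0.

Section PositivePart.
Context {R : realDomainType}.
Implicit Types t : R.

Lemma posp_ge0 t : 0 <= posp t.
Proof. by rewrite le_max lexx orbT. Qed.

Lemma posp_id t : 0 <= t -> posp t = t.
Proof. by move=> t0; apply/max_idPl. Qed.

Lemma posp_eq0 t : t <= 0 -> posp t = 0.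
Proof. by move=> t0; apply/max_idPr. Qed.

Lemma posp_gt0 t : (0 < posp t) = (0 < t).
Proof. by rewrite lt_max ltxx orbF. Qed.

Lemma pospM s t : 0 <= s -> posp (s * t) = s * posp t.
Proof.
move=> s0; have [t0|/ltW t0] := leP 0 t; first by rewrite !posp_id ?mulr_ge0.
by rewrite !posp_eq0 ?mulr0 // mulr_ge0_le0.
Qed.

End PositivePart.

Section TwistInteraction.
Context {R : realDomainType} {lam kap : R} {g : R -> R -> R}.
Hypothesis twg : twist_interaction lam kap g.

Lemma twist_lower a b s t : 0 <= s -> 0 <= t ->
  g (a - s) (b - t) + g a b - g (a - s) b - g a (b - t) <= - (lam * (s * t)).
Proof.
move=> s0 t0; have [+ _ _] := twg.
move=> /(_ (a - s) (b - t) s t s0 t0) /andP[_]; rewrite !subrK; lra.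
Qed.

(** The energy change of one bond whose end values (a, b) and (a', b') in two
configurations exchange their first components. *)
Lemma twist_exchange a b a' b' :
  g a' b + g a b' - g a b - g a' b'
  <= kap * posp ((a - a') * (b - b')) - lam * posp (- ((a - a') * (b - b'))).
Proof.
have [mixed _ _] := twg.
set s := a - a'; set t := b - b'.
have Ea : a' + s = a by rewrite /s subrKC.
have Eb : b' + t = b by rewrite /t subrKC.
have Ea' : a - s = a' by rewrite /s opprB subrKC.
have Eb' : b - t = b' by rewrite /t opprB subrKC.
have [s0|/ltW s0] := leP 0 s; have [t0|/ltW t0] := leP 0 t.
- have st0 := mulr_ge0 s0 t0.
  rewrite posp_id // posp_eq0 ?oppr_le0 // mulr0 subr0.
  by have := mixed a' b' s t s0 t0; rewrite Ea Eb => /andP[+ _]; lra.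
- have st0 : s * t <= 0 by rewrite mulr_ge0_le0.
  rewrite posp_eq0 // posp_id ?oppr_ge0 // mulr0 sub0r.
  have nt0 : 0 <= - t by rewrite oppr_ge0.
  have := mixed a' b s (- t) s0 nt0; rewrite Ea Eb' mulrN => /andP[_]; lra.
- have st0 : s * t <= 0 by rewrite mulr_le0_ge0.
  rewrite posp_eq0 // posp_id ?oppr_ge0 // mulr0 sub0r.
  have ns0 : 0 <= - s by rewrite oppr_ge0.
  have := mixed a b' (- s) t ns0 t0; rewrite Ea' Eb mulNr => /andP[_]; lra.
- have st0 : 0 <= s * t by rewrite mulr_le0.
  rewrite posp_id // posp_eq0 ?oppr_le0 // mulr0 subr0.
  have ns0 : 0 <= - s by rewrite oppr_ge0.
  have nt0 : 0 <= - t by rewrite oppr_ge0.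
  have := mixed a b (- s) (- t) ns0 nt0; rewrite Ea' Eb' mulrNN => /andP[+ _]; lra.
Qed.

End TwistInteraction.

Section Exchange.
Local Open Scope set_scope.
Context {R : realFieldType} {T : finType}.
Implicit Types (e : rel T) (X Y V z : T -> R) (A I : {set T}) (t : R).

Definition linked e : rel T := [rel i l | e i l || e l i].

Definition bond_energy e (g : T -> T -> R -> R -> R) X : R :=
  \sum_i \sum_(l | e i l) g i l (X i) (X l).

Definition minimizes (E : (T -> R) -> R) I X : Prop :=
  forall V, (forall i, i \notin I -> V i = X i) -> E X <= E V.

(** What minimality of x and y says about z = x - y.  The condition depends on
the sites only through [near] and the interior I, so on a line it is preserved by
reflection; exchanging the roles of x and y turns z into - z. *)
Definition exchange_stable (near : rel T) I (lam kap gam : R) z : Prop :=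
  forall A j, A \subset I -> j \in I -> j \notin A ->
    (forall i, i \in A -> 0 <= z i) ->
    gam * (\sum_(i in A | near i j) z i) ^+ 2
      + lam * (\sum_(i in A) \sum_(l | near i l) z i * posp (- z l))
    <= kap * (\sum_(i in A) \sum_(l | near i l && (l \notin A)) z i * posp (z l)).

(** Converts a sum over directed bonds into a sum over the bonds leaving A, read
from their end in A. *)
Lemma sum_bonds_cut e A (c : T -> T -> R) :
  (forall i l, e i l -> ~~ e l i) ->
  \sum_i \sum_(l | e i l) ((if (i \in A) && (l \notin A) then c i l else 0)
                         + (if (l \in A) && (i \notin A) then c l i else 0))
  = \sum_(i in A) \sum_(l | linked e i l && (l \notin A)) c i l.
Proof.
move=> asym.
under eq_bigr do rewrite big_split /=.
rewrite big_split /=.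
rewrite [X in _ + X](exchange_big_dep xpredT) //= -big_split /= [RHS]big_mkcond /=.
apply: eq_bigr => i _; rewrite big_mkcond [X in _ + X]big_mkcond -big_split /=.
case: (boolP (i \in A)) => iA /=; last first.
  by apply: big1 => l _; rewrite !if_same addr0.
rewrite [RHS]big_mkcond /=; apply: eq_bigr => l _.
rewrite /linked /=; have := asym i l; case: (e i l) => [/(_ isT)/negbTE ->|_] /=.
  by rewrite addr0.
by rewrite add0r; case: (e l i).
Qed.

Section Energy.
Context {e : rel T} {g : T -> T -> R -> R -> R} {I : {set T}} {lam kap Q : R}.
Hypothesis asym : forall i l, e i l -> ~~ e l i.
Hypothesis lam_gt0 : 0 < lam.
Hypothesis kap_ge0 : 0 <= kap.
Hypothesis Q_gt0 : 0 < Q.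
Hypothesis twg : forall i l, e i l -> twist_interaction lam kap (g i l).
Hypothesis degree : forall j, j \in I -> kap *+ #|[pred l | linked e j l]| <= Q.

Let E := bond_energy e g.

Definition displace X j t : T -> R := fun i => if i == j then X i + t else X i.

Lemma energy_second_variation X j t : j \in I -> 0 <= t ->
  E (displace X j t) + E (displace X j (- t)) - E X *+ 2 <= Q * t ^+ 2.
Proof.
move=> jI t0.
have kt0 : 0 <= kap * t ^+ 2 by rewrite mulr_ge0 ?sqr_ge0.
have -> : E (displace X j t) + E (displace X j (- t)) - E X *+ 2 =
  \sum_i \sum_(l | e i l) (g i l (displace X j t i) (displace X j t l)
     + g i l (displace X j (- t) i) (displace X j (- t) l) - g i l (X i) (X l) *+ 2).
  rewrite /E /bond_energy -sumrMnl -big_split -sumrB /=; apply: eq_bigr => i _.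
  by rewrite -sumrMnl -big_split -sumrB.
pose c (i l : T) := kap * t ^+ 2.
apply: (@le_trans _ _ (\sum_(i in [set j]) \sum_(l | linked e i l && (l \notin [set j]))
    c i l)).
  rewrite -(sum_bonds_cut _ c asym).
  apply: ler_sum => i _; apply: ler_sum => l eil.
  have [_ vert horiz] := twg eil.
  rewrite /displace /c !inE; have [ij|ij] := eqVneq i j; have [lj|lj] := eqVneq l j => /=.
  - by subst; have := asym eil; rewrite eil.
  - by rewrite addr0; apply: vert.
  - by rewrite add0r; apply: horiz.
  - by rewrite addr0 -mulr2n subrr.
rewrite big_set1 /c sumr_const -mulr_natr -mulrA [_ ^+ _ * _]mulrC mulrA mulr_natr.
apply: ler_wpM2r; first exact: sqr_ge0.
apply: le_trans (degree jI); apply: ler_wpMn2l => //.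
by apply: subset_leq_card; apply/fintype.subsetP => l; rewrite !inE => /andP[].
Qed.

(** Minimality against the opposite displacement replaces the vanishing of the
gradient of the energy. *)
Lemma minimizer_displace X j t : minimizes E I X -> j \in I -> 0 <= t ->
  E (displace X j (- t)) - E X <= Q * t ^+ 2.
Proof.
move=> minX jI t0.
have := energy_second_variation X jI t0.
have : E X <= E (displace X j t).
  by apply: minX => i iI; rewrite /displace; case: eqP iI => // ->; rewrite jI.
rewrite mulr2n; lra.
Qed.

Definition splice A X Y : T -> R := fun i => if i \in A then Y i else X i.

Lemma splice_off A X Y : A \subset I -> forall i, i \notin I -> splice A X Y i = X i.
Proof.
move=> /fintype.subsetP AI i iI; rewrite /splice; case: ifP => // /AI.
by rewrite (negbTE iI).
Qed.

(** Lowering the values on A makes it cheaper, by at least lam t times the mass of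
A in range of j, to lower the value at j by t; for the minimizer X itself that
displacement costs at most Q t^2, and t is chosen to optimize the balance. *)
Lemma splice_energy_gain A X Y j : minimizes E I X -> A \subset I ->
  j \in I -> j \notin A -> (forall i, i \in A -> Y i <= X i) ->
  E X + lam ^+ 2 / (4 * Q) * (\sum_(i in A | linked e i j) (X i - Y i)) ^+ 2
  <= E (splice A X Y).
Proof.
move=> minX AI jI jA leYX.
set s := \sum_(i in A | _) _.
have s0 : 0 <= s by apply: sumr_ge0 => i /andP[iA _]; rewrite subr_ge0 leYX.
set X' := splice A X Y.
have slide t : 0 <= t ->
    E (displace X' j (- t)) + E X - E X' - E (displace X j (- t)) <= - (lam * (t * s)).
  move=> t0.
  have -> : E (displace X' j (- t)) + E X - E X' - E (displace X j (- t)) =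
    \sum_i \sum_(l | e i l) (g i l (displace X' j (- t) i) (displace X' j (- t) l)
     + g i l (X i) (X l) - g i l (X' i) (X' l)
     - g i l (displace X j (- t) i) (displace X j (- t) l)).
    rewrite /E /bond_energy -big_split -!sumrB /=; apply: eq_bigr => i _.
    by rewrite -big_split -!sumrB.
  pose c (i l : T) := if l \in A then - (lam * (t * (X l - Y l))) else 0.
  apply: (@le_trans _ _ (\sum_(i in [set j]) \sum_(l | linked e i l && (l \notin [set j]))
      c i l)).
    rewrite -(sum_bonds_cut _ c asym).
    apply: ler_sum => i _; apply: ler_sum => l eil.
    rewrite /displace !inE /X' /splice /c.
    have [ij|ij] := eqVneq i j; have [lj|lj] := eqVneq l j => /=.
    - by subst; have := asym eil; rewrite eil.
    - subst i; rewrite (negbTE jA) addr0; case: ifP => lA; last by rewrite addrK subrr.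
      have := twist_lower (twg eil) (X j) (X l) t0 (_ : 0 <= X l - Y l).
      rewrite subr_ge0 leYX // !subKr => /(_ isT); lra.
    - subst l; rewrite (negbTE jA) add0r; case: ifP => iA; last by rewrite addrK subrr.
      have := twist_lower (twg eil) (X i) (X j) (_ : 0 <= X i - Y i) t0.
      rewrite subr_ge0 leYX // !subKr [_ * t]mulrC => /(_ isT); lra.
    - rewrite addr0; lra.
  rewrite big_set1 /c -big_mkcondr /s.
  rewrite le_eqVlt; apply/orP; left; apply/eqP.
  rewrite sumrN -mulr_sumr -mulr_sumr; congr (- (_ * (_ * _))).
  apply: eq_bigl => l; rewrite inE /linked /=.
  have [->|_] := eqVneq l j; first by rewrite (negbTE jA) andbF.
  by rewrite andbT andbC orbC.
pose t := lam * s / (2 * Q).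
have t0 : 0 <= t by rewrite divr_ge0 ?mulr_ge0 // ltW // mulr_gt0.
have H1 := slide t t0.
have H2 := minimizer_displace minX jI t0.
have H3 : E X <= E (displace X' j (- t)).
  apply: minX => i iI; rewrite /displace; case: eqP iI => [->|_ iI]; first by rewrite jI.
  exact: splice_off.
have -> : lam ^+ 2 / (4 * Q) * s ^+ 2 = lam * (t * s) - Q * t ^+ 2.
  by rewrite /t; field; rewrite gt_eqF.
lra.
Qed.

Lemma splice_energy_sum A X Y :
  E (splice A X Y) + E (splice A Y X) - E X - E Y
  <= \sum_(i in A) \sum_(l | linked e i l && (l \notin A))
       (kap * posp ((X i - Y i) * (X l - Y l))
        - lam * posp (- ((X i - Y i) * (X l - Y l)))).
Proof.
pose c i l := kap * posp ((X i - Y i) * (X l - Y l))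
        - lam * posp (- ((X i - Y i) * (X l - Y l))).
rewrite -/(c _ _) -(sum_bonds_cut _ c asym) /E /bond_energy -big_split -!sumrB /=.
apply: ler_sum => i _; rewrite -big_split -!sumrB /=; apply: ler_sum => l eil.
rewrite /splice /c; case: (i \in A); case: (l \in A) => /=; rewrite ?addr0 ?add0r.
- lra.
- exact: (twist_exchange (twg eil) (X i) (X l) (Y i) (Y l)).
- rewrite [g _ _ (X i) _ + _]addrC [(X l - Y l) * _]mulrC.
  exact: (twist_exchange (twg eil) (X i) (X l) (Y i) (Y l)).
- lra.
Qed.

(** One of the two spliced configurations has the surplus of energy provided by
[splice_energy_gain], the other one has no deficit, and [splice_energy_sum]
bounds their sum. *)
Lemma exchange_stable_minimizers X Y :
  minimizes E I X -> minimizes E I Y ->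
  exchange_stable (linked e) I lam kap (lam ^+ 2 / (4 * Q)) (fun i => X i - Y i).
Proof.
move=> minX minY A j AI jI jA z0.
have H1 := splice_energy_gain minX AI jI jA (fun i iA => etrans (esym (subr_ge0 _ _)) (z0 i iA)).
have H2 : E Y <= E (splice A Y X) by apply: minY; exact: splice_off.
have H3 := splice_energy_sum A X Y.
suff H4 : \sum_(i in A) \sum_(l | linked e i l && (l \notin A))
       (kap * posp ((X i - Y i) * (X l - Y l)) - lam * posp (- ((X i - Y i) * (X l - Y l))))
   = kap * (\sum_(i in A) \sum_(l | linked e i l && (l \notin A)) (X i - Y i) * posp (X l - Y l))
     - lam * (\sum_(i in A) \sum_(l | linked e i l) (X i - Y i) * posp (- (X l - Y l))).
  rewrite H4 in H3; lra.
rewrite !mulr_sumr -sumrB; apply: eq_bigr => i iA.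
have -> : \sum_(l | linked e i l) (X i - Y i) * posp (- (X l - Y l))
   = \sum_(l | linked e i l && (l \notin A)) (X i - Y i) * posp (- (X l - Y l)).
  rewrite (bigID (mem A)) /= big1 ?add0r // => l /andP[_ lA].
  by rewrite posp_eq0 ?mulr0 // oppr_le0 z0.
rewrite !mulr_sumr -sumrB; apply: eq_bigr => l _.
have zi : 0 <= X i - Y i := z0 i iA.
by rewrite -[- ((X i - Y i) * _)]mulrN !(pospM _ zi).
Qed.

End Energy.
End Exchange.

(** * Counting crossings *)

Section CrossingCount.
Context {R : realFieldType} {r d : nat} {lam kap gam : R}.
Hypothesis lam_gt0 : 0 < lam.
Hypothesis kap_gt0 : 0 < kap.
Hypothesis gam_gt0 : 0 < gam.
Local Open Scope set_scope.
(* Exchanges take place on d + 1 sites, at indices r to r + d; the r neighbours on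
   each side are those that these sites interact with. *)
Local Notation site := 'I_(d + r.*2).+1.
Implicit Types (z : site -> R) (a b : nat) (F : site -> R).

Definition within_range : rel site :=
  [rel i l : site | (i != l) && (i <= l + r)%N && (l <= i + r)%N].

Definition interior_sites : {set site} := [set i : site | (r <= i <= r + d)%N].

Local Notation stable := (exchange_stable within_range interior_sites lam kap gam).

Definition window F a : R := \sum_(i : site | (a <= i < a + r)%N) F i.
Definition positive_mass z := window (fun i => posp (z i)).
Definition negative_mass z := window (fun i => posp (- z i)).

(** A crossing is located by its positive site on the left and by its negative site
on the right: these are the sites that a cut exchanges. *)
Definition left_crossings z a : R :=
  \sum_(i : site | (i < a)%N) \sum_(l | within_range i l) posp (z i) * posp (- z l).

Definition right_crossings z b : R :=
  \sum_(i : site | (b <= i)%N) \sum_(l | within_range i l) posp (- z i) * posp (z l).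

(** Reversing the line and exchanging x with y: the combination preserves the
situation in which z is first positive and finally negative. *)
Definition reflect z : site -> R := fun i => - z (rev_ord i).

Lemma positive_mass_ge0 z a : 0 <= positive_mass z a.
Proof. by apply: sumr_ge0 => i _; apply: posp_ge0. Qed.

Lemma negative_mass_ge0 z a : 0 <= negative_mass z a.
Proof. by apply: sumr_ge0 => i _; apply: posp_ge0. Qed.

Lemma left_crossings_le z a b : (a <= b)%N -> left_crossings z a <= left_crossings z b.
Proof.
move=> ab; rewrite /left_crossings big_mkcond [leRHS]big_mkcond /=.
apply: ler_sum => i _; case: ifP => ia; first by rewrite (leq_trans ia ab).
by case: ifP => // _; apply: sumr_ge0 => l _; rewrite mulr_ge0 ?posp_ge0.
Qed.

Lemma within_range_rev i l : within_range (rev_ord i) (rev_ord l) = within_range i l.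
Proof.
rewrite /within_range /= (inj_eq rev_ord_inj) -!andbA; congr (_ && _).
have := ltn_ord i; have := ltn_ord l; lia.
Qed.

Lemma exchange_stable_reflect z :
  stable (fun i => - z i) -> stable (reflect z).
Proof.
move=> st A j AI jI jA z0.
pose A' : {set site} := [set i | rev_ord i \in A].
have intE i : (rev_ord i \in interior_sites) = (i \in interior_sites).
  by rewrite !inE /=; have := ltn_ord i; lia.
have reA (F : site -> R) : \sum_(i in A) F i = \sum_(i in A') F (rev_ord i).
  rewrite (reindex_inj rev_ord_inj) /=; apply: eq_bigl => i; by rewrite inE.
have jI' : rev_ord j \in interior_sites by rewrite intE.
have jA' : rev_ord j \notin A' by rewrite inE rev_ordK.
have A'I : A' \subset interior_sites.
  apply/fintype.subsetP => i; rewrite inE => /(fintype.subsetP AI).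
  by rewrite intE.
have z0' i : i \in A' -> 0 <= - z i.
  by rewrite inE => /z0; rewrite /reflect rev_ordK.
have := st A' (rev_ord j) A'I jI' jA' z0'.
congr (_ * _ ^+ 2 + _ * _ <= _ * _).
- rewrite [RHS](reindex_inj rev_ord_inj) /=; apply: eq_big => i.
    by rewrite inE -within_range_rev rev_ordK.
  by rewrite /reflect rev_ordK.
- rewrite reA; apply: eq_bigr => i _.
  rewrite [RHS](reindex_inj rev_ord_inj) /=; apply: eq_big => l.
    by rewrite within_range_rev.
  by rewrite /reflect !rev_ordK.
- rewrite reA; apply: eq_bigr => i _.
  rewrite [RHS](reindex_inj rev_ord_inj) /=; apply: eq_big => l.
    by rewrite within_range_rev inE.
  by rewrite /reflect !rev_ordK.
Qed.

Lemma window_rev F a b : (a + b + r = (d + r.*2).+1)%N ->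
  window (fun i => F (rev_ord i)) a = window F b.
Proof.
move=> ab; rewrite /window [RHS](reindex_inj rev_ord_inj) /=.
apply: eq_bigl => i; have := ltn_ord i; lia.
Qed.

Lemma positive_mass_reflect z a b : (a + b + r = (d + r.*2).+1)%N ->
  positive_mass (reflect z) a = negative_mass z b.
Proof. exact: (@window_rev (fun i => posp (- z i))). Qed.

Lemma negative_mass_reflect z a b : (a + b + r = (d + r.*2).+1)%N ->
  negative_mass (reflect z) a = positive_mass z b.
Proof.
move=> ab; rewrite /positive_mass -(window_rev _ ab).
by apply: eq_bigr => i _; rewrite /reflect opprK.
Qed.

Lemma left_crossings_reflect z a b : (a + b = (d + r.*2).+1)%N ->
  left_crossings (reflect z) a = right_crossings z b.
Proof.
move=> ab; rewrite /left_crossings /right_crossings [RHS](reindex_inj rev_ord_inj) /=.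
apply: eq_big => i; first by have := ltn_ord i; lia.
move=> _; rewrite [RHS](reindex_inj rev_ord_inj) /=; apply: eq_big => l.
  by rewrite within_range_rev.
by rewrite /reflect opprK.
Qed.

(** A consists of the positive sites before a, and j = a.  A positive site outside
A is at least a, so only bonds over the cut can cost energy, and their total cost
is at most the product of the masses on the two sides of the cut. *)
Lemma exchange_left z a : stable z -> (forall i : site, (i < r)%N -> z i <= 0) ->
  (r <= a <= r + d)%N ->
  gam * (window (fun i => posp (z i)) (a - r)) ^+ 2 + lam * left_crossings z a
  <= kap * (positive_mass z (a - r) * positive_mass z a).
Proof.
move=> st zl /andP[ra ad].
pose A : {set site} := [set i : site | (i < a)%N & 0 < z i].
have aN : (a < (d + r.*2).+1)%N by lia.
pose j : site := Ordinal aN.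
have AI : A \subset interior_sites.
  apply/fintype.subsetP => i; rewrite !inE => /andP[ia zi].
  case: (ltnP i r) => ir /=; last by lia.
  by have := zl i ir; rewrite leNgt zi.
have jI : j \in interior_sites by rewrite inE /=; lia.
have jA : j \notin A by rewrite inE /= ltnn.
have A0 i : i \in A -> 0 <= z i by rewrite inE => /andP[_ /ltW].
have := st A j AI jI jA A0.
have -> : \sum_(i in A | within_range i j) z i = window (fun i => posp (z i)) (a - r).
  rewrite /window big_mkcond [RHS]big_mkcond /=; apply: eq_bigr => i _.
  rewrite inE /within_range /= -val_eqE /=.
  have [zi|zi] := ltP 0 (z i); last by rewrite andbF /= posp_eq0 // if_same.
  rewrite (posp_id (ltW zi)) andbT; congr (if _ then _ else _).
  by lia.
have -> : \sum_(i in A) \sum_(l | within_range i l) z i * posp (- z l) = left_crossings z a.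
  rewrite /left_crossings big_mkcond [RHS]big_mkcond /=; apply: eq_bigr => i _.
  rewrite inE; case: (ltnP i a) => ia //=.
  have [zi|zi] := ltP 0 (z i); first by apply: eq_bigr => l _; rewrite (posp_id (ltW zi)).
  by rewrite big1 // => l _; rewrite (posp_eq0 zi) mul0r.
move=> H; apply: le_trans H _; apply: ler_wpM2l; first exact: ltW.
rewrite /positive_mass /window big_distrlr /= big_mkcond [leRHS]big_mkcond /=.
apply: ler_sum => i _; rewrite inE.
have [zi|zi] := ltP 0 (z i); last first.
  rewrite andbF; case: ifP => // _; apply: sumr_ge0 => l _.
  by rewrite mulr_ge0 ?posp_ge0.
case: (ltnP i a) => ia /=; last by case: ifP => // _; apply: sumr_ge0 => l _;
  rewrite mulr_ge0 ?posp_ge0.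
case: ifP => win; last first.
  rewrite big1 // => l /andP[/andP[/andP[_ il] li]]; rewrite inE negb_and.
  have [zl0|zl0] := ltP 0 (z l); last by rewrite posp_eq0 ?mulr0.
  rewrite orbF => la; exfalso; lia.
rewrite big_mkcond [leRHS]big_mkcond; apply: ler_sum => l _ /=.
rewrite (posp_id (ltW zi)).
case: (ifP (a <= l < a + r)%N) => win'.
  by case: ifP => _ //; rewrite mulr_ge0 ?posp_ge0 // ltW.
case: ifP => // /andP[/andP[/andP[_ il] li]]; rewrite inE negb_and.
have [zl0|zl0] := ltP 0 (z l); last by rewrite posp_eq0 ?mulr0.
by rewrite orbF => la; exfalso; lia.
Qed.

(** The quadratic term of [exchange_left] removes the mass before the cut:
kap u v - gam u^2 is at most kap^2 v^2 / (4 gam). *)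
Lemma left_crossings_le_mass z a : stable z -> (forall i : site, (i < r)%N -> z i <= 0) ->
  (r <= a <= r + d)%N ->
  left_crossings z a <= kap ^+ 2 / (4 * gam * lam) * positive_mass z a ^+ 2.
Proof.
move=> st zl ad; have := exchange_left st zl ad.
rewrite -/(positive_mass z (a - r)).
set u := positive_mass z (a - r); set v := positive_mass z a; set X := left_crossings z a.
move=> H; have g0 : gam != 0 by rewrite gt_eqF.
have l0 : lam != 0 by rewrite gt_eqF.
rewrite -(ler_pM2l lam_gt0).
have -> : lam * (kap ^+ 2 / (4 * gam * lam) * v ^+ 2) = kap ^+ 2 / (4 * gam) * v ^+ 2.
  by field; rewrite g0 l0.
have sq : 0 <= gam * (u - kap * v / (2 * gam)) ^+ 2 by rewrite mulr_ge0 ?sqr_ge0 ?ltW.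
have E : gam * (u - kap * v / (2 * gam)) ^+ 2
   = gam * u ^+ 2 - kap * (u * v) + kap ^+ 2 / (4 * gam) * v ^+ 2.
  by field.
rewrite E in sq; lra.
Qed.

(** Otherwise cut just after the last positive site before a: nothing pays for the
exchange, while the quadratic term is positive. *)
Lemma positive_mass_gt0 z a : stable z -> (forall i : site, (i < r)%N -> z i <= 0) ->
  (forall i : site, val i = r -> 0 < z i) ->
  (0 < r)%N -> (r < a <= r + d)%N -> 0 < positive_mass z a.
Proof.
move=> st zl zr r0 /andP[ra ad]; rewrite lt0r positive_mass_ge0 andbT; apply/eqP => v0.
have zmass (i : site) : (a <= i < a + r)%N -> z i <= 0.
  move=> win; rewrite leNgt; apply/negP => zi.
  have : 0 < positive_mass z a; last by rewrite v0 ltxx.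
  rewrite /positive_mass /window (bigD1 i) //= ltr_pwDl ?posp_gt0 //.
  by apply: sumr_ge0 => l _; apply: posp_ge0.
have rN : (r < (d + r.*2).+1)%N by lia.
case: (@arg_maxnP site (Ordinal rN) (fun i : site => (i < a)%N && (0 < z i)) (fun i => i)).
  by rewrite /= ra zr.
move=> m /andP[ma zm] mmax.
have rm : (r <= m)%N by rewrite leqNgt; apply/negP => /zl; rewrite leNgt zm.
have v1 : positive_mass z m.+1 = 0.
  apply: big1 => i win; apply: posp_eq0; rewrite leNgt; apply/negP => zi.
  case: (ltnP i a) => ia; last first.
    by have := zmass i; rewrite leNgt zi => /(_ ltac:(lia)).
  have := mmax i; rewrite ia zi => /(_ isT); lia.
have := exchange_left st zl (_ : (r <= m.+1 <= r + d)%N).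
rewrite v1 !mulr0 => /(_ ltac:(lia)); apply/negP; rewrite -ltNge.
apply: ltr_pwDl; last first.
  rewrite mulr_ge0 ?(ltW lam_gt0) //; apply: sumr_ge0 => i _; apply: sumr_ge0 => l _.
  by rewrite mulr_ge0 ?posp_ge0.
rewrite mulr_gt0 // exprn_gt0 // /window (bigD1 m) /=; last by lia.
by rewrite ltr_pwDl ?posp_gt0 //; apply: sumr_ge0 => l _; apply: posp_ge0.
Qed.

(** Exchange of the single site i.  It replaces the Euler-Lagrange equation, with
the advantage that the value at i itself does not appear. *)
Lemma exchange_site z (i : site) : stable z -> (r < i <= r + d)%N -> 0 < z i ->
  lam * \sum_(l | within_range i l) posp (- z l) <= kap * \sum_(l | within_range i l) posp (z l).
Proof.
move=> st id zi.
have rN : (r < (d + r.*2).+1)%N by lia.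
(* The first interior site serves as j; its quadratic term is dropped. *)
have AI : [set i] \subset interior_sites by rewrite finset.sub1set inE; lia.
have jI : Ordinal rN \in interior_sites by rewrite inE /=; lia.
have jA : Ordinal rN \notin [set i] by rewrite inE -val_eqE /=; lia.
have z0 j : j \in [set i] -> 0 <= z j by rewrite inE => /eqP ->; exact: ltW.
have := st _ _ AI jI jA z0; rewrite !big_set1 -!mulr_sumr.
have -> : \sum_(l | within_range i l && (l \notin [set i])) posp (z l)
   = \sum_(l | within_range i l) posp (z l).
  apply: eq_bigl => l; rewrite inE /within_range /=.
  by case: (eqVneq l i) => [->|_]; rewrite ?eqxx ?andbT.
move=> H; rewrite -(ler_pM2l zi).
apply: le_trans (_ : kap * (z i * \sum_(l | within_range i l) posp (z l)) <= _); last by rewrite mulrCA.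
apply: le_trans H; rewrite mulrCA lerDr mulr_ge0 ?sqr_ge0 //; exact: ltW.
Qed.

(** The situation in which the order of x and y is reversed across the domain of
crossing. *)
Record crossing_profile z : Prop := CrossingProfile {
  profile_stable : stable z;
  profile_stableN : stable (fun i => - z i);
  profile_left : forall i : site, (i < r)%N -> z i <= 0;
  profile_first : forall i : site, val i = r -> 0 < z i;
  profile_last : forall i : site, val i = (r + d)%N -> z i < 0;
  profile_right : forall i : site, (r + d < i)%N -> 0 <= z i }.

Lemma crossing_profile_reflect z : crossing_profile z -> crossing_profile (reflect z).
Proof.
move=> [st stN zl zf ze zr]; split.
- exact: exchange_stable_reflect.
- have <- : reflect (fun i => - z i) = (fun i => - reflect z i) by [].
  apply: exchange_stable_reflect.
  suff -> : (fun i => - - z i) = z by [].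
  by apply/funext => i; rewrite opprK.
- by move=> i ir; rewrite oppr_le0 zr //=; lia.
- by move=> i ir; rewrite oppr_gt0 ze //=; move: ir => /= ->; lia.
- by move=> i ir; rewrite oppr_lt0 zf //=; move: ir => /= ->; lia.
- by move=> i ir; rewrite oppr_ge0 zl //=; have := ltn_ord i; lia.
Qed.

(** Any two sites of a window are in range of each other, so this product is a sum
of crossings inside the window. *)
Definition block_product z a := positive_mass z a * negative_mass z a.

Lemma block_product_reflect z a b : (a + b + r = (d + r.*2).+1)%N ->
  block_product (reflect z) a = block_product z b.
Proof.
by move=> ab; rewrite /block_product (positive_mass_reflect _ ab)
  (negative_mass_reflect _ ab) mulrC.
Qed.

Definition local_crossings z a :=
  block_product z a + block_product z (a + r) + block_product z (a + r + r).

Lemma within_range_window b (i l : site) :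
  (b <= i < b + r)%N -> (b <= l < b + r)%N -> within_range i l = (i != l).
Proof. by move=> ib lb; rewrite /within_range /= -andbA; case: (i != l) => //=; lia. Qed.

Lemma sum_within_range_le F a (i : site) : (forall l, 0 <= F l) ->
  (a + r <= i < a + r + r)%N ->
  \sum_(l | within_range i l) F l <= window F a + window F (a + r) + window F (a + r + r).
Proof.
move=> F0 ia; rewrite /window big_mkcond.
rewrite [X in _ <= X + _ + _]big_mkcond [X in _ <= _ + X + _]big_mkcond.
rewrite [X in _ <= _ + X]big_mkcond -!big_split; apply: ler_sum => l _ /=.
have pos (b : bool) : 0 <= if b then F l else 0 by case: b.
case: ifP => [/andP[/andP[_ il] li]|_]; last by rewrite !addr_ge0.
have : [|| (a <= l < a + r), (a + r <= l < a + r + r) | (a + r + r <= l < a + r + r + r)]%N.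
  by clear -ia il li; lia.
case/or3P => ->; first by rewrite -addrA lerDl addr_ge0.
  by rewrite addrAC lerDr addr_ge0.
by rewrite lerDr addr_ge0.
Qed.

Lemma left_crossings_cat z a :
  left_crossings z a + block_product z a <= left_crossings z (a + r).
Proof.
have -> : left_crossings z (a + r) = left_crossings z a
  + window (fun i => \sum_(l | within_range i l) posp (z i) * posp (- z l)) a.
  rewrite /left_crossings /window big_mkcond [in RHS]big_mkcond /=.
  rewrite [X in _ = _ + X]big_mkcond -big_split /=; apply: eq_bigr => i _.
  case: (ltnP i a) => ia /=; first by rewrite (_ : (i < a + r)%N) ?addr0 //; lia.
  by rewrite add0r.
rewrite lerD2l /block_product /positive_mass /negative_mass /window big_distrlr /=.
apply: ler_sum => i ia; rewrite big_mkcond [leRHS]big_mkcond; apply: ler_sum => l _ /=.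
case: ifP => la; last by case: ifP => // _; rewrite mulr_ge0 ?posp_ge0.
rewrite (within_range_window ia la); case: (eqVneq i l) => //= <-.
have [zi|/ltW zi] := leP (z i) 0; first by rewrite posp_eq0 ?mul0r.
by rewrite [posp (- z i)]posp_eq0 ?mulr0 // oppr_le0.
Qed.

Lemma local_crossings_le z a :
  left_crossings z a + local_crossings z a <= left_crossings z (a + 4 * r).
Proof.
have H1 := left_crossings_cat z a.
have H2 := left_crossings_cat z (a + r).
have H3 := left_crossings_cat z (a + r + r).
have H4 : left_crossings z (a + r + r + r) <= left_crossings z (a + 4 * r).
  by apply: left_crossings_le; lia.
rewrite /local_crossings; lra.
Qed.

(** A crossing whose positive site is not before a + 4 r has its negative site,
which is at distance at most r, not before a + 3 r. *)
Lemma total_crossings_le z a :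
  left_crossings z (d + r.*2).+1 <= left_crossings z (a + 4 * r) + right_crossings z (a + 3 * r).
Proof.
rewrite /left_crossings /right_crossings.
have -> : \sum_(i : site | (a + 3 * r <= i)%N)
     \sum_(l | within_range i l) posp (- z i) * posp (z l)
   = \sum_(i : site) \sum_(l : site | (a + 3 * r <= l)%N && within_range i l)
       posp (z i) * posp (- z l).
  rewrite (exchange_big_dep xpredT) //=; apply: eq_bigr => i _.
  apply: eq_big => l; last by rewrite mulrC.
  by rewrite /within_range /= eq_sym -!andbA; congr (_ && _); congr (_ && _); rewrite andbC.
rewrite big_mkcond [X in _ <= X + _]big_mkcond -big_split /=.
apply: ler_sum => i _; rewrite ltn_ord.
case: (ltnP i (a + 4 * r)) => ia.
  by rewrite lerDl; apply: sumr_ge0 => l _; rewrite mulr_ge0 ?posp_ge0.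
rewrite add0r le_eqVlt; apply/orP; left; apply/eqP; apply: eq_bigl => l.
case wil : (within_range i l); last by rewrite andbF.
by move: wil => /= /andP[/andP[_ +] _]; lia.
Qed.

Lemma window_gt0P F a : 0 < window (fun i => posp (F i)) a ->
  exists2 i : site, (a <= i < a + r)%N & 0 < F i.
Proof.
move=> w0; apply: contrapT => noi; move: w0; rewrite /window big1 ?ltxx // => i ia.
by apply: posp_eq0; rewrite leNgt; apply/negP => Fi; apply: noi; exists i.
Qed.

Lemma negative_mass_gt0 z a : crossing_profile z -> (0 < r)%N ->
  (0 < a)%N -> (a + r <= r + d)%N -> 0 < negative_mass z a.
Proof.
move=> /crossing_profile_reflect [st _ zl zf _ _] r0 a0 ad.
have e : ((d + r.*2).+1 - a - r + a + r = (d + r.*2).+1)%N by lia.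
by rewrite -(positive_mass_reflect _ e); apply: positive_mass_gt0 => //; lia.
Qed.

Lemma le_min_three (c X u v w : R) : 0 <= u -> 0 <= v -> 0 <= w ->
  X <= c * u ^+ 2 -> X <= c * v ^+ 2 -> X <= c * w ^+ 2 ->
  exists m, [/\ 0 <= m, m <= u, m <= v, m <= w & X <= c * m ^+ 2].
Proof.
move=> u0 v0 w0 Xu Xv Xw.
have [uv|/ltW vu] := leP u v.
- have [uw|/ltW wu] := leP u w; first by exists u; split.
  by exists w; split => //; apply: le_trans uv.
- have [vw|/ltW wv] := leP v w; first by exists v; split.
  by exists w; split => //; apply: le_trans vu.
Qed.

(** With m the least positive mass of the three windows, the crossings on the left
are at most a multiple of m^2.  A negative site of the middle window has that
whole window in range, so exchanging it bounds m by a multiple of the negative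
mass N of the three windows, and m N is at most the local crossings. *)
Lemma left_crossings_le_local z a : crossing_profile z -> (0 < r)%N ->
  (r < a)%N -> (a + 3 * r <= r + d)%N ->
  left_crossings z a <= kap ^+ 3 / (4 * gam * lam ^+ 2) * local_crossings z a.
Proof.
move=> pz r0 ra ad.
have [b1 b2 b3] : [/\ r <= a <= r + d, r <= a + r <= r + d & r <= a + r + r <= r + d]%N.
  by split; lia.
have [i ia zi] : exists2 i : site, (a + r <= i < a + r + r)%N & 0 < - z i.
  by apply/window_gt0P/negative_mass_gt0 => //; lia.
have iI : (r < i <= r + d)%N by lia.
have [st stN zl _ _ _] := pz.
set c := kap ^+ 2 / (4 * gam * lam).
have c0 : 0 <= c by rewrite divr_ge0 ?exprn_ge0 ?mulr_ge0 // ltW.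
have mass b : (a <= b)%N -> (r <= b <= r + d)%N ->
    left_crossings z a <= c * positive_mass z b ^+ 2.
  move=> ab bd; apply: le_trans (left_crossings_le z ab) _.
  exact: left_crossings_le_mass.
have X1 := mass a (leqnn a) b1.
have X2 := mass (a + r)%N (leq_addr _ _) b2.
have X3 : left_crossings z a <= c * positive_mass z (a + r + r) ^+ 2.
  by apply: mass b3; rewrite -addnA leq_addr.
have [m [m0 m1 m2 m3 Xm]] := le_min_three (positive_mass_ge0 z a) (positive_mass_ge0 z (a + r))
  (positive_mass_ge0 z (a + r + r)) X1 X2 X3.
have := exchange_site stN iI zi.
have H1 : positive_mass z (a + r) <= \sum_(l | within_range i l) posp (- - z l).
  rewrite /positive_mass /window big_mkcond [leRHS]big_mkcond; apply: ler_sum => l _ /=.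
  rewrite opprK; case: ifP => la; last by case: ifP => // _; rewrite posp_ge0.
  rewrite (within_range_window ia la); case: (eqVneq i l) => //= <-.
  by rewrite posp_eq0 //; move: zi; rewrite oppr_gt0 => /ltW.
set N1 := negative_mass z a; set N2 := negative_mass z (a + r).
set N3 := negative_mass z (a + r + r).
have H2 : \sum_(l | within_range i l) posp (- z l) <= N1 + N2 + N3.
  by apply: sum_within_range_le ia => l; apply: posp_ge0.
move=> H3.
have n1 : 0 <= N1 := negative_mass_ge0 z a.
have n2 : 0 <= N2 := negative_mass_ge0 z (a + r).
have n3 : 0 <= N3 := negative_mass_ge0 z (a + r + r).
have H4 : lam * m <= kap * (N1 + N2 + N3).
  apply: le_trans (le_trans H3 _); last by apply: ler_wpM2l H2; exact: ltW.
  by apply: ler_wpM2l; [exact: ltW|exact: le_trans m2 H1].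
have H5 : m * (N1 + N2 + N3) <= local_crossings z a.
  rewrite /local_crossings /block_product -/N1 -/N2 -/N3 !mulrDr.
  by rewrite !lerD // ler_wpM2r.
have -> : kap ^+ 3 / (4 * gam * lam ^+ 2) * local_crossings z a
    = c * (kap * local_crossings z a / lam).
  by rewrite /c; field; rewrite !gt_eqF.
apply: le_trans Xm _; apply: (ler_wpM2l c0); rewrite ler_pdivlMr //.
apply: le_trans (ler_wpM2l (ltW kap_gt0) H5).
have -> : m ^+ 2 * lam = m * (lam * m) by ring.
by rewrite [leRHS]mulrCA; exact: (ler_wpM2l m0).
Qed.

Lemma local_crossings_reflect z a b : (a + b + 3 * r = (d + r.*2).+1)%N ->
  local_crossings (reflect z) a = local_crossings z b.
Proof.
move=> ab; rewrite /local_crossings.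
rewrite (@block_product_reflect z a (b + r + r)); last by lia.
rewrite (@block_product_reflect z (a + r) (b + r)); last by lia.
rewrite (@block_product_reflect z (a + r + r) b); last by lia.
by rewrite addrC addrA addrAC.
Qed.

Lemma right_crossings_le_local z a : crossing_profile z -> (0 < r)%N ->
  (r < a)%N -> (a + 3 * r <= r + d)%N ->
  right_crossings z (a + 3 * r) <= kap ^+ 3 / (4 * gam * lam ^+ 2) * local_crossings z a.
Proof.
move=> pz r0 ra ad; pose b := ((d + r.*2).+1 - (a + 3 * r))%N.
rewrite -(@left_crossings_reflect z b); last by rewrite /b; lia.
rewrite -(@local_crossings_reflect z b); last by rewrite /b; lia.
by apply: left_crossings_le_local; rewrite /b; [exact: crossing_profile_reflect|lia|lia|lia].
Qed.

(** A crossing is to the left of a, or to the right of a + 3 r, or has its positive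
site between a and a + 4 r, and the first two kinds amount to at most q times the
third each.  So the total T of all crossings is at most 1 + 2 q times those of
the third kind, and summing over disjoint stretches of 4 r sites gives
n T <= (1 + 2 q) T. *)
Lemma crossing_count_le z n : crossing_profile z -> (0 < r)%N -> (4 * r * n <= d)%N ->
  n%:R <= 1 + kap ^+ 3 / (2 * gam * lam ^+ 2).
Proof.
move=> pz r0; set q := kap ^+ 3 / (4 * gam * lam ^+ 2).
have q0 : 0 <= q by rewrite divr_ge0 ?exprn_ge0 ?mulr_ge0 ?exprn_ge0 // ltW.
have -> : 1 + kap ^+ 3 / (2 * gam * lam ^+ 2) = 1 + 2 * q.
  by rewrite /q; congr (_ + _); field; rewrite !gt_eqF.
case: n => [_|n nd]; first by rewrite addr_ge0 // mulr_ge0.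
set T := left_crossings z (d + r.*2).+1.
have step a : (r < a)%N -> (a + 3 * r <= r + d)%N ->
    T <= (1 + 2 * q) * (left_crossings z (a + 4 * r) - left_crossings z a).
  move=> ra ad; have [st stN zl zf _ _] := pz.
  have H1 := total_crossings_le z a.
  have H2 := left_crossings_le_local pz r0 ra ad.
  have H3 := right_crossings_le_local pz r0 ra ad.
  have H4 := local_crossings_le z a.
  rewrite -/q in H2 H3; rewrite -/T in H1.
  have := ler_wpM2l q0 (_ : local_crossings z a <= left_crossings z (a + 4 * r) - left_crossings z a).
  rewrite lerBrDl => /(_ H4); lra.
have left0 a : 0 <= left_crossings z a.
  by apply: sumr_ge0 => i _; apply: sumr_ge0 => l _; rewrite mulr_ge0 ?posp_ge0.
have tele k : (4 * r * k <= d)%N ->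
    k%:R * T <= (1 + 2 * q) * left_crossings z (r.+1 + 4 * r * k).
  elim: k => [_|k IH kd]; first by rewrite mul0r mulr_ge0 // addr_ge0 // mulr_ge0.
  have := IH ltac:(lia).
  have := step (r.+1 + 4 * r * k)%N ltac:(lia) ltac:(lia).
  rewrite (_ : (r.+1 + 4 * r * k + 4 * r)%N = (r.+1 + 4 * r * k.+1)%N); last by lia.
  rewrite -[k.+1]addn1 natrD; lra.
have T0 : 0 < T.
  have : 0 < block_product z r.+1.
    rewrite mulr_gt0 ?(negative_mass_gt0 pz) //; last by lia.
    by have [st _ zl zf _ _] := pz; apply: positive_mass_gt0 => //; lia.
  have := left_crossings_cat z r.+1; have := left0 r.+1.
  have := @left_crossings_le z (r.+1 + r) (d + r.*2).+1 ltac:(lia).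
  rewrite -/T; lra.
rewrite -(ler_pM2r T0); apply: le_trans (tele _ nd) _.
apply: ler_wpM2l; first by rewrite addr_ge0 // mulr_ge0.
by apply: left_crossings_le; lia.
Qed.

End CrossingCount.

(** * Blocks of a local energy *)

Lemma exchange_stable_eq (R : realFieldType) (T : finType) (near near' : rel T)
    (I : {set T}) (lam kap gam : R) (z : T -> R) :
  (forall i l, i \in I -> near i l = near' i l) ->
  exchange_stable near I lam kap gam z -> exchange_stable near' I lam kap gam z.
Proof.
move=> nearE st A j AI jI jA z0; have := st A j AI jI jA z0.
have AE i l : i \in A -> near i l = near' i l by move=> /(fintype.subsetP AI); exact: nearE.
congr (_ * _ ^+ 2 + _ * _ <= _ * _).
- apply: eq_bigl => i; case: (boolP (i \in A)) => //= iA; exact: AE.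
- apply: eq_bigr => i iA; apply: eq_bigl => l; exact: AE.
- apply: eq_bigr => i iA; apply: eq_bigl => l; by rewrite AE.
Qed.

Lemma card_ord_interval N m k : (#|[pred l : 'I_N | (m <= l < m + k)%N]| <= k)%N.
Proof.
rewrite cardE -(size_map val) -[leqRHS](size_iota m k).
apply: uniq_leq_size; first by rewrite map_inj_uniq ?enum_uniq //; exact: val_inj.
by move=> n /mapP[l]; rewrite mem_enum inE => lm ->; rewrite mem_iota.
Qed.

Section BlockEnergy.
Context {R : realType} {r d : nat} {K lam : R}.
Hypothesis r_gt0 : (0 < r)%N.
Hypothesis K_gt0 : 0 < K.
Hypothesis lam_gt0 : 0 < lam.
Context {S : 'rV[R]_r.+1 -> R} {h : 'I_r -> R -> R -> R}.
Hypothesis S_pairs : forall xi, S xi = \sum_(j < r) h j (xi 0 ord0) (xi 0 (lift ord0 j)).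
Hypothesis twh : forall j, twist_interaction lam (K / r%:R) (h j).
Context {j0 : int}.
Local Notation site := 'I_(d + r.*2).+1.
Implicit Types x y v : int -> R.

Definition restrict x : site -> R := fun i => x (j0 - r%:Z + i%:Z).

(** The block energy adds S_i for i in [j0 - r, j0 + d], so its bonds start at the
   indices 0 to d + r; every bond with an interior end starts there. *)
Definition bond : rel site := [rel i l : site | (i < (d + r).+1) && (i < l <= i + r)]%N.

(** The default value is never taken: bonds have length between 1 and r. *)
Definition bond_interaction (i l : site) : R -> R -> R :=
  h (insubd (Ordinal r_gt0) (l - i).-1).

Lemma block_energyE x :
  block_energy S j0 (j0 + d%:Z) x = bond_energy bond bond_interaction (restrict x).
Proof.
rewrite /block_energy (reindex_fsbig (fun n : nat => j0 - r%:Z + n%:Z) `I_(d + r).+1); last first.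
  split.
  - by move=> n /=; lia.
  - by move=> m n _ _ /=; lia.
  - move=> k /= kD; exists (absz (k - (j0 - r%:Z))%R) => /=; lia.
rewrite -fsbig_ord /bond_energy.
pose F n := site_energy S (j0 - r%:Z + n%:Z) x.
rewrite (big_ord_widen (d + r.*2).+1 F); last by lia.
rewrite big_mkcond; apply: eq_bigr => i _ /=.
case: (ltnP i (d + r).+1) => id /=; last by apply/esym/big_pred0 => l; rewrite /bond /=; lia.
rewrite /F /site_energy S_pairs.
pose G l := h (insubd (Ordinal r_gt0) (l - i).-1) (x (j0 - r%:Z + i%:Z)) (x (j0 - r%:Z + l%:Z)).
transitivity (\sum_(i.+1 <= l < r + i.+1) G l).
  rewrite -{1}[i.+1]add0n big_addn addnK big_mkord; apply: eq_bigr => k _.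
  rewrite !mxE /G.
  rewrite (_ : insubd _ _ = k); last first.
    have Ek : (k + i.+1 - i).-1 = k by rewrite addnS subSn ?leq_addl //= addnK.
    by apply: val_inj; rewrite val_insubd Ek ltn_ord.
  by congr (h k (x _) (x _)); rewrite /= ?/bump /=; lia.
rewrite (big_nat_widen _ _ (d + r.*2).+1); last by lia.
rewrite (big_nat_widenl _ 0) //.
rewrite big_mkord; apply: eq_bigl => l; rewrite /bond /=; lia.
Qed.

Lemma restrict_minimizes x : global_minimizer S x ->
  minimizes (bond_energy bond bond_interaction) (@interior_sites r d) (restrict x).
Proof.
move=> minx V VI.
pose v (k : int) := if (j0 <= k <= j0 + d%:Z) then V (inord (absz (k - (j0 - r%:Z))%R)) - x k else 0.
have := minx j0 (j0 + d%:Z) v; rewrite lerDl => /(_ isT).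
have v0 i : ~~ (j0 <= i <= j0 + d%:Z) -> v i = 0 by rewrite /v => /negbTE ->.
move=> /(_ v0); rewrite !block_energyE.
suff -> : restrict (fun i => x i + v i) = V by [].
apply/funext => i; rewrite /restrict /v; case: ifP => iI.
  rewrite addrC subrK; congr V; apply: val_inj; rewrite /= inordK; first by lia.
  by have := ltn_ord i; lia.
rewrite addr0; have := VI i; rewrite inE => ->//; lia.
Qed.

Lemma linked_bond (i l : site) : i \in @interior_sites r d -> linked bond i l = within_range i l.
Proof.
rewrite inE /linked /bond /within_range /= -val_eqE /= => iI.
have := ltn_ord l; lia.
Qed.

Lemma exchange_stable_global_minimizers x y :
  global_minimizer S x -> global_minimizer S y ->
  exchange_stable (@within_range r d) (@interior_sites r d) lam (K / r%:R)
    (lam ^+ 2 / (8 * K)) (fun i => restrict x i - restrict y i).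
Proof.
move=> minx miny.
apply: exchange_stable_eq linked_bond _.
have -> : lam ^+ 2 / (8 * K) = lam ^+ 2 / (4 * (2 * K)).
  by congr (_ / _); ring.
apply: exchange_stable_minimizers (restrict_minimizes minx) (restrict_minimizes miny).
- by move=> i l; rewrite /bond /=; lia.
- exact: lam_gt0.
- by rewrite divr_ge0 // ltW.
- by rewrite mulr_gt0.
- by move=> i l _; exact: twh.
- move=> j jI.
  have card2r : (#|[pred l | linked bond j l]| <= 2 * r)%N.
    rewrite [leqRHS]mul2n -[leqRHS]addnn.
    apply: leq_trans (leq_add (card_ord_interval (d + r.*2).+1 (j - r) r)
      (card_ord_interval (d + r.*2).+1 j.+1 r)).
    rewrite -cardUI; apply: leq_trans (leq_addr _ _).
    apply: subset_leq_card; apply/fintype.subsetP => l.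
    rewrite !inE /linked /bond /=; lia.
  apply: le_trans (ler_wpMn2l _ card2r) _; first by rewrite divr_ge0 // ltW.
  by rewrite mulnC mulrnA -[_ *+ r]mulr_natr divfK ?pnatr_eq0 -?lt0n // mulr_natl.
Qed.

End BlockEnergy.

(** * The ends of the domain of crossing *)

Section DomainOfCrossing.
Context {R : realType} {x y : int -> R} {j0 j1 : int}.

Lemma zcomponent_left_ray : j0 <= j1 ->
  zcomponent (~` [set i : int | j0 <= i <= j1]) [set i : int | i < j0].
Proof.
move=> j01; split.
- by exists (j0 - 1) => /=; lia.
- by move=> a b /= aj bj c; lia.
- by move=> i /=; lia.
move=> C' intC' C'D rayC'; apply/seteqP; split => // i C'i /=.
rewrite ltNge; apply/negP => ij.
have : (~` [set i : int | j0 <= i <= j1]) j0 by apply/C'D/(intC' (j0 - 1) i) => //; [apply: rayC' => /=; lia|lia].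
by move=> /=; rewrite lexx j01.
Qed.

Lemma zcomponent_right_ray : j0 <= j1 ->
  zcomponent (~` [set i : int | j0 <= i <= j1]) [set i : int | j1 < i].
Proof.
move=> j01; split.
- by exists (j1 + 1) => /=; lia.
- by move=> a b /= aj bj c; lia.
- by move=> i /=; lia.
move=> C' intC' C'D rayC'; apply/seteqP; split => // i C'i /=.
rewrite ltNge; apply/negP => ij.
have : (~` [set i : int | j0 <= i <= j1]) j1 by apply/C'D/(intC' i (j1 + 1)) => //; [apply: rayC' => /=; lia|lia].
by move=> /=; rewrite lexx j01.
Qed.

Lemma ordered_off_rays a b : a <= b ->
  weakly_ordered_on [set i : int | i < a] x y ->
  weakly_ordered_on [set i : int | b < i] x y ->
  ordered_off [set i : int | a <= i <= b] x y.
Proof.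
move=> ab oL oR C [[c Cc] intC CD _].
have sub (A : set int) : C `<=` A -> weakly_ordered_on A x y -> weakly_ordered_on C x y.
  by move=> CA [] o; [left|right]; move=> i /CA /o.
have notD i : C i -> ~ (a <= i <= b) by exact: CD.
have [ca|ac] := ltP c a.
- apply: sub oL => i Ci /=; rewrite ltNge; apply/negP => ai.
  by apply: (notD a); [apply: (intC c i); rewrite // (ltW ca) ai|rewrite lexx ab].
- have bc : b < c by rewrite ltNge; apply/negP => cb; apply: (notD c Cc); rewrite ac cb.
  apply: sub oR => i Ci /=; rewrite ltNge; apply/negP => ib.
  by apply: (notD b); [apply: (intC i c); rewrite // ib (ltW bc)|rewrite lexx ab].
Qed.

Hypothesis j01 : j0 < j1.
Hypothesis domD : domain_of_crossing x y [set i : int | j0 <= i <= j1].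

(** If the order left of D extended to the first site of D, then D without that
site would contradict minimality of D. *)
Lemma domain_left_end :
  ((forall i, i < j0 -> x i <= y i) /\ y j0 < x j0)
  \/ ((forall i, i < j0 -> y i <= x i) /\ x j0 < y j0).
Proof.
have [_ oD minD] := domD.
have oR := oD _ (zcomponent_right_ray (ltW j01)).
have nL : ~ weakly_ordered_on [set i : int | i < j0 + 1] x y.
  move=> oL.
  have lt' : j0 + 1 <= j1 by lia.
  have : [set i : int | j0 + 1 <= i <= j1] j0.
    rewrite (minD _ _ (ordered_off_rays lt' oL oR)) /=.
    - by rewrite lexx ltW.
    - by move=> a b /= aj bj c; lia.
    - by move=> i /=; lia.
  by move=> /=; lia.
have ext (i : int) : [set i | i < j0 + 1] i -> i = j0 \/ i < j0.
  by move=> /=; lia.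
case: (oD _ (zcomponent_left_ray (ltW j01))) => o; [left|right]; split => //.
- rewrite ltNge; apply/negP => le0; apply: nL; left => i /ext [->//|]; exact: o.
- rewrite ltNge; apply/negP => le0; apply: nL; right => i /ext [->//|]; exact: o.
Qed.

Lemma domain_right_end :
  ((forall i, j1 < i -> x i <= y i) /\ y j1 < x j1)
  \/ ((forall i, j1 < i -> y i <= x i) /\ x j1 < y j1).
Proof.
have [_ oD minD] := domD.
have oL := oD _ (zcomponent_left_ray (ltW j01)).
have nR : ~ weakly_ordered_on [set i : int | j1 - 1 < i] x y.
  move=> oR.
  have lt' : j0 <= j1 - 1 by lia.
  have : [set i : int | j0 <= i <= j1 - 1] j1.
    rewrite (minD _ _ (ordered_off_rays lt' oL oR)) /=.
    - by rewrite lexx ltW.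
    - by move=> a b /= aj bj c; lia.
    - by move=> i /=; lia.
  by move=> /=; lia.
have ext (i : int) : [set i | j1 - 1 < i] i -> i = j1 \/ j1 < i.
  by move=> /=; lia.
case: (oD _ (zcomponent_right_ray (ltW j01))) => o; [left|right]; split => //.
- rewrite ltNge; apply/negP => le0; apply: nR; left => i /ext [->//|]; exact: o.
- rewrite ltNge; apply/negP => le0; apply: nR; right => i /ext [->//|]; exact: o.
Qed.

End DomainOfCrossing.

Section Bound.
Context {R : realType} {r : nat} {K lam : R} {S : 'rV[R]_r.+1 -> R}.
Hypothesis r_gt0 : (0 < r)%N.
Hypothesis K_gt0 : 0 < K.
Hypothesis lam_gt0 : 0 < lam.
Hypothesis energyS : is_local_energy K lam S.

Lemma local_energy_pairs : exists h : 'I_r -> R -> R -> R,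
  [/\ forall xi, S xi = \sum_(j < r) h j (xi 0 ord0) (xi 0 (lift ord0 j)),
      forall j, twist_interaction lam (K / r%:R) (h j)
    & lam <= K / r%:R].
Proof.
have [_ [f [C2f Sf hf]]] := energyS.
have bnd j i k p : `|partial i (partial k (f j)) p| <= K / r%:R.
  have [_ + _ _] := hf j => /(_ i k); rewrite -lee_fin; apply: le_trans.
  by apply: ereal_sup_ubound; exists p.
exists (fun j nu mu => f j (pt2 nu mu)); split => //.
  move=> j; apply: twist_of_partials => //.
  by have [] := hf j.
have [_ _ _ /(_ 0 0)] := hf (Ordinal r_gt0).
have := bnd (Ordinal r_gt0) 0 1 (pt2 0 0); rewrite ler_norml => /andP[lo _] hi.
have := le_trans lo hi; by rewrite lerN2.
Qed.

Lemma exchange_stable_difference d (j0 : int) x y :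
  global_minimizer S x -> global_minimizer S y ->
  exchange_stable (@within_range r d) (@interior_sites r d) lam (K / r%:R)
    (lam ^+ 2 / (8 * K))
    (fun i => x (j0 - r%:Z + (i : nat)%:Z) - y (j0 - r%:Z + (i : nat)%:Z)).
Proof.
move=> minx miny; have [h [Sh twh _]] := local_energy_pairs.
exact: (exchange_stable_global_minimizers r_gt0 K_gt0 lam_gt0 Sh twh minx miny).
Qed.

Let kap_gt0 : 0 < K / r%:R. Proof. by rewrite divr_gt0 // ltr0n. Qed.
Let gam_gt0 : 0 < lam ^+ 2 / (8 * K).
Proof. by rewrite divr_gt0 ?exprn_gt0 // mulr_gt0. Qed.

(** The interior is enlarged by the site j1 + 1, so that the cut after all positive
sites is again an interior site. *)
Lemma same_order_impossible (j0 j1 : int) x y : j0 < j1 ->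
  global_minimizer S x -> global_minimizer S y ->
  (forall i, i < j0 -> x i <= y i) -> y j0 < x j0 ->
  (forall i, j1 < i -> x i <= y i) -> False.
Proof.
move=> j01 minx miny left first right.
pose d := (absz (j1 - j0)%R).+1.
pose z (i : 'I_(d + r.*2).+1) := x (j0 - r%:Z + (i : nat)%:Z) - y (j0 - r%:Z + (i : nat)%:Z).
have st := exchange_stable_difference (d := d) (j0 := j0) minx miny.
have : 0 < positive_mass z (r + d).
  apply: (positive_mass_gt0 lam_gt0 kap_gt0 gam_gt0 st) => //.
  - by move=> i ir; rewrite /z subr_le0; apply: left; lia.
  - by move=> i /= ir; rewrite /z ir subrK subr_gt0.
  - by lia.
rewrite /positive_mass /window big1 ?ltxx // => i win.
by rewrite posp_eq0 // /z subr_le0; apply: right; lia.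
Qed.

Lemma opposite_order_count (j0 : int) d n x y :
  global_minimizer S x -> global_minimizer S y ->
  (forall i, i < j0 -> x i <= y i) -> y j0 < x j0 ->
  (forall i, j0 + d%:Z < i -> y i <= x i) -> x (j0 + d%:Z) < y (j0 + d%:Z) ->
  (4 * r * n <= d)%N ->
  n%:R <= 1 + 4 * K ^+ 4 / (r%:R ^+ 3 * lam ^+ 4).
Proof.
move=> minx miny left first right last nd.
pose z (i : 'I_(d + r.*2).+1) := x (j0 - r%:Z + (i : nat)%:Z) - y (j0 - r%:Z + (i : nat)%:Z).
have pz : @crossing_profile R r d lam (K / r%:R) (lam ^+ 2 / (8 * K)) z.
  split.
  - exact: exchange_stable_difference.
  - have := exchange_stable_difference (d := d) (j0 := j0) miny minx.
    by congr (exchange_stable _ _ _ _ _ _); apply/funext => i; rewrite /z opprB.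
  - by move=> i ir; rewrite /z subr_le0; apply: left; lia.
  - by move=> i /= ir; rewrite /z ir subrK subr_gt0.
  - by move=> i /= ir; rewrite /z ir PoszD addrA subrK subr_lt0.
  - by move=> i ir; rewrite /z subr_ge0; apply: right; lia.
have := crossing_count_le lam_gt0 kap_gt0 gam_gt0 pz r_gt0 nd.
congr (_ <= _ + _).
by field; rewrite !gt_eqF // ltr0n.
Qed.

(** With n the number of whole stretches of 4 r sites in D, the length of D is at
most 4 r (n + 1) <= 4 r (2 + 4 t), where t = (K / lam)^4 is at least 1 because
r lam <= K. *)
Lemma opposite_order_bound (j0 j1 : int) x y : j0 <= j1 ->
  global_minimizer S x -> global_minimizer S y ->
  (forall i, i < j0 -> x i <= y i) -> y j0 < x j0 ->
  (forall i, j1 < i -> y i <= x i) -> x j1 < y j1 ->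
  (j1 - j0)%:~R <= 12 * r%:R * lam ^- 2 * (2 * K ^+ 2 * (2 * r%:R + 1) / lam) ^+ 2 + 3 * r%:R :> R.
Proof.
move=> j01 minx miny left first right last.
pose d := absz (j1 - j0)%R.
have j1E : j1 = j0 + d%:Z by rewrite /d; lia.
rewrite j1E [_ - _]addrC addKr -pmulrn.
rewrite j1E in right last.
pose n := (d %/ (4 * r))%N.
have nd : (4 * r * n <= d)%N by rewrite mulnC leq_trunc_div.
have dn : (d < 4 * r * n.+1)%N by rewrite mulnC ltn_ceil //; lia.
have count := opposite_order_count minx miny left first right last nd.
have [_ [_ _ lamK]] := local_energy_pairs.
have rR : 1 <= r%:R :> R by rewrite ler1n.
have rR0 : 0 < r%:R :> R by rewrite ltr0n.
set t := K ^+ 4 / lam ^+ 4.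
have t1 : 1 <= t.
  have le_lamK : lam <= K by apply: le_trans lamK _; rewrite ler_pdivrMr // ler_peMr // ltW.
  by rewrite ler_pdivlMr ?exprn_gt0 // mul1r lerXn2r // nnegrE ltW.
have -> : 12 * r%:R * lam ^- 2 * (2 * K ^+ 2 * (2 * r%:R + 1) / lam) ^+ 2
  = 48 * r%:R * t * (2 * r%:R + 1) ^+ 2.
  by rewrite /t; field; rewrite gt_eqF.
have {}count : n%:R <= 1 + 4 * t.
  apply: le_trans count _; rewrite lerD2l -mulrA ler_pM2l // /t.
  rewrite ler_pM2l ?exprn_gt0 // lef_pV2 ?posrE ?mulr_gt0 ?exprn_gt0 //.
  by rewrite ler_peMl ?exprn_ege1 // exprn_ge0 // ltW.
have {}dn : d%:R <= 4 * r%:R * (n%:R + 1) :> R.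
  by rewrite -[1]/(1%:R) -natrD addn1 -!natrM ler_nat ltnW.
have rt : r%:R <= r%:R * t by rewrite ler_peMr // ltW.
have r9 : 9 <= (2 * r%:R + 1) ^+ 2 :> R by nra.
have H1 : r%:R * n%:R <= r%:R * (1 + 4 * t) by rewrite ler_pM2l.
have H2 : r%:R * t * 9 <= r%:R * t * (2 * r%:R + 1) ^+ 2.
  by rewrite ler_pM2l // (lt_le_trans rR0 rt).
have : 0 <= r%:R * t by apply: le_trans rt; exact: ltW.
move: dn H1 H2 rt; lra.
Qed.

End Bound.

Unset Implicit Arguments.

Theorem theoremA (R : realType) (r : nat) (K lam : R)
    (hr : (1 <= r)%N) (hK : 0 < K) (hlam : 0 < lam)
    (S : 'rV[R]_r.+1 -> R) (hS : is_local_energy K lam S)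
    (x y : int -> R) (hx : global_minimizer S x) (hy : global_minimizer S y)
    (j0 j1 : int) (hj : j0 <= j1)
    (hD : domain_of_crossing x y [set i : int | j0 <= i <= j1]) :
  let c : R := 2 * K ^+ 2 * (2 * r%:R + 1) / lam in
  j1 - j0 <= Num.ceil (12 * r%:R * lam ^- 2 * c ^+ 2 + 3 * r%:R).
Proof.
cbv zeta; set c := 2 * K ^+ 2 * (2 * r%:R + 1) / lam.
suff le_bound : (j1 - j0)%:~R <= 12 * r%:R * lam ^- 2 * c ^+ 2 + 3 * r%:R.
  by rewrite -(ler_int R); apply: le_trans le_bound _; exact: Num.Theory.ceil_ge.
have [j01|j10] := ltP j0 j1; last first.
  have -> : j1 = j0 by apply/eqP; rewrite eq_le j10 hj.
  by rewrite subrr addr_ge0 ?mulr_ge0 ?invr_ge0 ?exprn_ge0 ?sqr_ge0 // ltW.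
have [[l f]|[l f]] := domain_left_end j01 hD;
  have [[rt e]|[rt e]] := domain_right_end j01 hD.
- by case: (same_order_impossible hr hK hlam hS j01 hx hy l f rt).
- exact: (opposite_order_bound hr hK hlam hS hj hx hy l f rt e).
- exact: (opposite_order_bound hr hK hlam hS hj hy hx l f rt e).
- by case: (same_order_impossible hr hK hlam hS j01 hy hx l f rt).
Qed.
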